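(* For every $\lambda>0$, the Lorentzian Lie algebra $(\mathfrak h_3\oplus\mathbb R,S_0^2)$, with the product structure $J$, is flat with respect to the canonical connection $\nabla^0$, i.e. $R^0_{uv}w=0$ for all $u,v,w\in\mathfrak h_3\oplus\mathbb R$.
   Context: $\mathfrak h_3\oplus\mathbb R$ is the real Lie algebra with basis $e_1,e_2,e_3,e_4$ and only non-zero bracket (up to skew-symmetry) $[e_1,e_2]=e_3$. $S_0^2$ (depending on $\lambda>0$) is the Lorentzian inner product $\langle\cdot,\cdot\rangle$ whose matrix in $(e_1,e_2,e_3,e_4)$ is $\begin{bmatrix}1&0&0&0\\0&0&1&0\\0&1&0&0\\0&0&0&\lambda\end{bmatrix}$. Fix the basis $v_1=e_1$, $v_2=\frac1{\sqrt\lambda}e_4$, $v_3=\frac1{\sqrt2}(e_2+e_3)$, $v_4=\frac1{\sqrt2}(e_2-e_3)$, which is orthonormal: $\langle v_i,v_j\rangle=0$ for $i\ne j$, $\langle v_i,v_i\rangle=1$ for $i=1,2,3$, $\langle v_4,v_4\rangle=-1$. The product structure $J$ is the linear map with $Jv_i=v_i$ for $i=1,2,3$ and $Jv_4=-v_4$. Write $\mathfrak g$ for the Lie algebra. The Levi-Civita connection is the bilinear map $\nabla:\mathfrak g\times\mathfrak g\to\mathfrak g$ with $2\langle\nabla_uv,w\rangle=\langle[u,v],w\rangle+\langle[w,u],v\rangle+\langle[w,v],u\rangle$ for all $u,v,w$. Put $(\nabla_uJ)v=\nabla_u(Jv)-J(\nabla_uv)$. The canonical connection is $\nabla^0_uv=\nabla_uv-\frac12(\nabla_uJ)Jv$,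 and its curvature is $R^0_{uv}w=\nabla^0_{[u,v]}w-\nabla^0_u\nabla^0_vw+\nabla^0_v\nabla^0_uw$. *)

(* Defs.v *)
From HB Require Import structures.
From mathcomp Require Import all_boot all_order all_algebra.
From mathcomp Require Import reals.
From mathcomp Require Import ring lra.

Set Implicit Arguments.
Unset Strict Implicit.
Unset Printing Implicit Defensive.

Import Order.TTheory GRing.Theory Num.Theory.
Local Open Scope ring_scope.

Section Connections.
Variables (R : realType) (V : lmodType R).
Variables (br : V -> V -> V) (form : V -> V -> R).
Implicit Types (nabla : V -> V -> V) (J : V -> V).

Definition is_lie_bracket :=
  [/\ forall a u v w, br (a *: u + v) w = a *: br u w + br v w,
      forall a u v w, br w (a *: u + v) = a *: br w u + br w v,
      forall u, br u u = 0
    & forall u v w, br u (br v w) + br v (br w u) + br w (br u v) = 0].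

(* [nabla u v] is the covariant derivative of v in the direction u; the
   equation is Koszul's formula for left-invariant vector fields. *)
Definition is_levi_civita nabla :=
  forall u v w,
    2 * form (nabla u v) w
      = form (br u v) w + form (br w u) v + form (br w v) u.

Definition cov_endo nabla J (u v : V) : V := nabla u (J v) - J (nabla u v).

Definition canonical_connection nabla J (u v : V) : V :=
  nabla u v - 2^-1 *: cov_endo nabla J u (J v).

(* The sign is opposite to the other usual convention
   [nabla_u, nabla_v] - nabla_[u,v]. *)
Definition curvature nabla (u v w : V) : V :=
  nabla (br u v) w - nabla u (nabla v w) + nabla v (nabla u w).

Definition flat_connection nabla := forall u v w, curvature nabla u v w = 0.

End Connections.

(* The Lie algebra h_3 (+) R is 'rV[R]_4, with coordinates in the basis
   (e1, e2, e3, e4) numbered from 0: the e2-coordinate of u is [u 0 1]. *)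
Section H3R.
Variable R : realType.
Implicit Types (lambda : R) (u v w : 'rV[R]_4).

Definition e1 : 'rV[R]_4 := delta_mx 0 0.
Definition e2 : 'rV[R]_4 := delta_mx 0 1.
Definition e3 : 'rV[R]_4 := delta_mx 0 2.
Definition e4 : 'rV[R]_4 := delta_mx 0 3.

(* The bilinear alternating extension of [e1, e2] = e3; see [h3R_brE]. *)
Definition h3R_br u v : 'rV[R]_4 := (u 0 0 * v 0 1 - u 0 1 * v 0 0) *: e3.

Definition S02 lambda : 'M[R]_4 :=
  \matrix_(i, j) nth 0 (nth [::] [:: [:: 1; 0; 0; 0];
                                     [:: 0; 0; 1; 0];
                                     [:: 0; 1; 0; 0];
                                     [:: 0; 0; 0; lambda]] i) j.

Definition S02_form lambda u v : R := (u *m S02 lambda *m v^T) 0 0.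

Definition v1 : 'rV[R]_4 := e1.
Definition v2 lambda : 'rV[R]_4 := (Num.sqrt lambda)^-1 *: e4.
Definition v3 : 'rV[R]_4 := (Num.sqrt 2)^-1 *: (e2 + e3).
Definition v4 : 'rV[R]_4 := (Num.sqrt 2)^-1 *: (e2 - e3).

Definition is_product_structure lambda (J : 'rV[R]_4 -> 'rV[R]_4) :=
  [/\ J v1 = v1, J (v2 lambda) = v2 lambda, J v3 = v3 & J v4 = - v4].

Let ord4P (P : 'I_4 -> Prop) : P 0 -> P 1 -> P 2 -> P 3 -> forall i, P i.
Proof.
move=> P0 P1 P2 P3 [[|[|[|[|//]]]] Hi].
- by rewrite (_ : Ordinal Hi = 0) //; apply: val_inj.
- by rewrite (_ : Ordinal Hi = 1) //; apply: val_inj.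
- by rewrite (_ : Ordinal Hi = 2) //; apply: val_inj.
- by rewrite (_ : Ordinal Hi = 3) //; apply: val_inj.
Qed.

Let rV4P u v : u 0 0 = v 0 0 -> u 0 1 = v 0 1 -> u 0 2 = v 0 2 ->
  u 0 3 = v 0 3 -> u = v.
Proof. by move=> *; apply/rowP; apply: ord4P. Qed.

Let sum4 (F : 'I_4 -> R) : \sum_i F i = F 0 + F 1 + F 2 + F 3.
Proof.
rewrite !big_ord_recr big_ord0 /= add0r.
by congr (F _ + F _ + F _ + F _); apply: val_inj.
Qed.

Lemma rV4E u : u = u 0 0 *: e1 + u 0 1 *: e2 + u 0 2 *: e3 + u 0 3 *: e4.
Proof. by apply: rV4P; rewrite !mxE /=; ring. Qed.

Lemma S02_formE lambda u v :
  S02_form lambda u v = u 0 0 * v 0 0 + u 0 1 * v 0 2 + u 0 2 * v 0 1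
                        + lambda * (u 0 3 * v 0 3).
Proof. by rewrite /S02_form mxE sum4 !mxE !sum4 !mxE /=; ring. Qed.

Lemma h3R_brE :
  [/\ h3R_br e1 e2 = e3, h3R_br e1 e3 = 0 & h3R_br e1 e4 = 0] /\
  [/\ h3R_br e2 e3 = 0, h3R_br e2 e4 = 0 & h3R_br e3 e4 = 0].
Proof. by split; split; apply: rV4P; rewrite !mxE /=; ring. Qed.

Lemma h3R_br_lie : is_lie_bracket h3R_br.
Proof. by split=> *; apply: rV4P; rewrite !mxE /=; ring. Qed.

Lemma sqrt2V : (Num.sqrt 2)^-1 ^+ 2 = 2^-1 :> R.
Proof. by rewrite exprVn sqr_sqrtr. Qed.

Lemma S02_form_orthonormal lambda : 0 < lambda ->
  let B := S02_form lambda in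
  [/\ B v1 v1 = 1, B (v2 lambda) (v2 lambda) = 1, B v3 v3 = 1 & B v4 v4 = -1]
  /\ [/\ B v1 (v2 lambda) = 0, B v1 v3 = 0 & B v1 v4 = 0]
  /\ [/\ B (v2 lambda) v3 = 0, B (v2 lambda) v4 = 0 & B v3 v4 = 0].
Proof.
move=> l0 B; rewrite /B.
have hl : (Num.sqrt lambda)^-1 ^+ 2 * lambda = 1.
  by rewrite exprVn sqr_sqrtr ?ltW // mulVf // gt_eqF.
have h2 := sqrt2V.
by split; [|split]; split; rewrite S02_formE !mxE /=; nra.
Qed.

Definition lc_witness u v : 'rV[R]_4 := u 0 1 *: (v 0 1 *: e1 - v 0 0 *: e3).

Let lc_witness_bilinear : bilinear_for *:%R *:%R lc_witness.
Proof. by split=> ? ? ? ?; apply: rV4P; rewrite !mxE /=; ring. Qed.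

HB.instance Definition _ := bilinear_isBilinear.Build
  R 'rV[R]_4 'rV[R]_4 'rV[R]_4 *:%R *:%R lc_witness lc_witness_bilinear.

Lemma levi_civita_exists lambda :
  exists nabla : {bilinear 'rV[R]_4 -> 'rV[R]_4 -> 'rV[R]_4},
    is_levi_civita h3R_br (S02_form lambda) nabla.
Proof.
by exists lc_witness => u v w; rewrite !S02_formE !mxE /=; ring.
Qed.

Lemma levi_civita_unique lambda (n1 n2 : 'rV[R]_4 -> 'rV[R]_4 -> 'rV[R]_4) :
  0 < lambda ->
  is_levi_civita h3R_br (S02_form lambda) n1 ->
  is_levi_civita h3R_br (S02_form lambda) n2 -> forall u v, n1 u v = n2 u v.
Proof.
move=> l0 h1 h2 u v.
have h w : S02_form lambda (n1 u v) w = S02_form lambda (n2 u v) w.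
  apply: (@mulfI _ (2 : R)); first by rewrite pnatr_eq0.
  by rewrite h1 h2.
have := (h e1, h e2, h e3, h e4).
rewrite !S02_formE !mxE /= => -[[[k1 k2] k3] k4]; apply: rV4P; try lra.
by apply: (@mulfI _ lambda); [rewrite gt_eqF | lra].
Qed.

Definition J_witness u : 'rV[R]_4 :=
  u 0 0 *: e1 + u 0 2 *: e2 + u 0 1 *: e3 + u 0 3 *: e4.

Let J_witness_linear : linear J_witness.
Proof. by move=> ? ? ?; apply: rV4P; rewrite !mxE /=; ring. Qed.

HB.instance Definition _ :=
  GRing.isLinear.Build R 'rV[R]_4 'rV[R]_4 _ J_witness J_witness_linear.

Lemma product_structure_exists lambda :
  exists J : {linear 'rV[R]_4 -> 'rV[R]_4}, is_product_structure lambda J.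
Proof.
by exists J_witness; split; apply: rV4P; rewrite !mxE /=; ring.
Qed.

Lemma product_structure_unique lambda (J1 J2 : {linear 'rV[R]_4 -> 'rV[R]_4}) :
  0 < lambda -> is_product_structure lambda J1 ->
  is_product_structure lambda J2 -> J1 =1 J2.
Proof.
move=> l0 [a1 a2 a3 a4] [b1 b2 b3 b4] u.
have sl0 : Num.sqrt lambda != 0 by rewrite gt_eqF // sqrtr_gt0.
have s20 : Num.sqrt 2 != 0 :> R by rewrite gt_eqF // sqrtr_gt0 ltr0n.
have h2 : (Num.sqrt 2) ^+ 2 = 2 :> R by rewrite sqr_sqrtr.
have -> : u = u 0 0 *: v1 + (u 0 3 * Num.sqrt lambda) *: v2 lambda
  + ((u 0 1 + u 0 2) * Num.sqrt 2 / 2) *: v3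
  + ((u 0 1 - u 0 2) * Num.sqrt 2 / 2) *: v4.
  by apply: rV4P; rewrite !mxE /=; field; rewrite ?sl0 ?s20.
have Jlin (J : {linear 'rV[R]_4 -> 'rV[R]_4}) a b c d w1 w2 w3 w4 :
    J (a *: w1 + b *: w2 + c *: w3 + d *: w4)
      = a *: J w1 + b *: J w2 + c *: J w3 + d *: J w4.
  by rewrite !linearD !linearZ.
by rewrite !Jlin a1 a2 a3 a4 b1 b2 b3 b4.
Qed.

End H3R.

(* Main.v *)
Require Import Defs.
From mathcomp Require Import all_boot all_order all_algebra.
From mathcomp Require Import reals.
From mathcomp Require Import ring.
Import Order.TTheory GRing.Theory Num.Theory.
Local Open Scope ring_scope.

(** Since [J] is the swap of [e2] and [e3], the canonical connection is
    [nabla0 u = (u_2 / 2) B] for one fixed endomorphism [B].  Hence the operators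
    [nabla0 u] commute, and [nabla0 [u, v] = 0] because brackets are multiples of
    [e3]: the curvature vanishes term by term. *)

Lemma rV4P (R : realType) (u v : 'rV[R]_4) :
  u 0 0 = v 0 0 -> u 0 1 = v 0 1 -> u 0 2 = v 0 2 -> u 0 3 = v 0 3 -> u = v.
Proof.
move=> h0 h1 h2 h3; apply/rowP => -[[|[|[|[|//]]]] Hi].
- by rewrite (_ : Ordinal Hi = 0) //; apply: val_inj.
- by rewrite (_ : Ordinal Hi = 1) //; apply: val_inj.
- by rewrite (_ : Ordinal Hi = 2) //; apply: val_inj.
- by rewrite (_ : Ordinal Hi = 3) //; apply: val_inj.
Qed.

(** [levi_civita_exists] hides its witness; uniqueness needs it by name. *)
Lemma lc_witness_levi_civita (R : realType) (lambda : R) :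
  is_levi_civita (@h3R_br R) (S02_form lambda) (@lc_witness R).
Proof. by move=> u v w; rewrite !S02_formE !mxE /=; ring. Qed.

Lemma J_witness_product_structure (R : realType) (lambda : R) :
  is_product_structure lambda (@J_witness R).
Proof. by split; apply: rV4P; rewrite !mxE /=; ring. Qed.

(** As [J] squares to the identity, the connection is the average of [nabla u] and [J (nabla u) J].
    The result is an infinitesimal rotation of the plane of [v1] and [v3], scaled by the
    [e2]-coordinate of [u]. *)
Lemma canonical_connection_witness (R : realType) (u v : 'rV[R]_4) :
  canonical_connection (@lc_witness R) (@J_witness R) u v
    = (2^-1 * u 0 1) *: ((v 0 1 + v 0 2) *: e1 R - v 0 0 *: (e2 R + e3 R)).
Proof. by apply: rV4P; rewrite !mxE /=; field. Qed.

Theorem theorem4p9 (R : realType) (lambda : R)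
    (nabla : {bilinear 'rV[R]_4 -> 'rV[R]_4 -> 'rV[R]_4})
    (J : {linear 'rV[R]_4 -> 'rV[R]_4}) :
  0 < lambda ->
  is_levi_civita (@h3R_br R) (S02_form lambda) nabla ->
  is_product_structure lambda J ->
  flat_connection (@h3R_br R) (canonical_connection nabla J).
Proof.
move=> l0 lc_nabla psJ u v w.
(* Uniqueness turns the given [nabla] and [J] into the explicit witnesses. *)
have nablaE := levi_civita_unique l0 lc_nabla (lc_witness_levi_civita R lambda).
have JE : J =1 @J_witness R :=
  product_structure_unique l0 psJ (J_witness_product_structure R lambda).
have ccE a b : canonical_connection nabla J a b
    = canonical_connection (@lc_witness R) (@J_witness R) a b.
  by rewrite /canonical_connection /cov_endo !nablaE !JE.
rewrite /curvature !ccE !canonical_connection_witness.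
by apply: rV4P; rewrite !mxE /=; ring.
Qed.
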